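(* Being a closed mapping is not preserved under the relation of $L$-equivalence, even within the class of finite-to-one retractions. That is, there exist finite-to-one retractions $f: X\to Y$ and $g: Z\to T$ of topological spaces that are $L$-equivalent and such that $f$ is closed while $g$ is not closed. In particular, being a perfect mapping is not $L$-invariant: there exist $L$-equivalent continuous mappings one of which is perfect and the other is not.
   Context: All topological spaces are Tychonoff; all locally convex spaces are real and Hausdorff. A retraction is a continuous mapping $r: X\to K$ onto a subspace (or a space identified with a subspace) $K\subset X$ with $r(x)=x$ for all $x\in K$. A mapping is finite-to-one if all its fibers are finite. A perfect mapping is a continuous closed mapping with compact fibers. A property of mappings is $L$-invariant if it is preserved by the relation of $L$-equivalence. The free locally convex space $L(X)$ over $X$ is a locally convex space with a continuous injection $\delta_X: X\to L(X)$ such that $L(X)$ is the linear span of $\delta_X(X)$ and every continuous $f: X\to E$ to a locally convex space $E$ satisfies $f=f_\#\circ\delta_X$ for a (unique) continuous linear $f_\#: L(X)\to E$. It exists and is unique up to topological isomorphism, $\delta_X$ is a closed topological embedding, and $X$ is identified with $\delta_X(X)$. For continuous $f: X\to Y$, $f_\#: L(X)\to L(Y)$ denotes the continuous linear extension of $f$. Continuous mappings $f: X\to Y$ and $g: Z\to T$ are $L$-equivalent if there are topological isomorphisms (linear homeomorphisms) $\varphi: L(X)\to L(Z)$ and $\psi: L(Y)\to L(T)$ with $\psi\circ f_\#=g_\#\circ\varphi$. *)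

(* Defs.v *)
From HB Require Import structures.
From mathcomp Require Import all_boot all_order all_algebra.
From mathcomp Require Import all_classical all_reals topology normedtype.

Set Implicit Arguments.
Unset Strict Implicit.
Unset Printing Implicit Defensive.

Import Order.TTheory GRing.Theory Num.Theory.
Import numFieldTopology.Exports.

Local Open Scope classical_set_scope.
Local Open Scope ring_scope.

Definition tychonoff_space (X : topologicalType) : Prop :=
  accessible_space X /\ completely_regular_space X.

Definition embedding (X Y : topologicalType) (i : X -> Y) : Prop :=
  [/\ injective i, continuous i &
      forall U : set X, open U -> exists2 V : set Y, open V & i @^-1` V = U].

Definition homeomorphism (X Y : topologicalType) (h : X -> Y) : Prop :=
  continuous h /\
  exists k : Y -> X, [/\ continuous k, cancel h k & cancel k h].

(* The codomain [Y] is identified with a subspace of [X] through [i];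
   [cancel i f] says that [f] is the identity on that subspace. *)
Definition retraction (X Y : topologicalType) (f : X -> Y) : Prop :=
  continuous f /\ exists2 i : Y -> X, embedding i & cancel i f.

Definition finite_to_one (X Y : Type) (f : X -> Y) : Prop :=
  forall y : Y, finite_set (f @^-1` [set y]).

Definition closed_map (X Y : topologicalType) (f : X -> Y) : Prop :=
  forall A : set X, closed A -> closed (f @` A).

Definition perfect_map (X Y : topologicalType) (f : X -> Y) : Prop :=
  [/\ continuous f, closed_map f &
      forall y : Y, compact (f @^-1` [set y])].

(* [tvsType R] is the library's type of locally convex spaces; it does not
   include the Hausdorff axiom, which is therefore required of [L] and of
   every target space [E]. *)
Definition is_free_lcs (R : realType) (X : topologicalType)
    (L : tvsType R) (d : X -> L) : Prop :=
  [/\ hausdorff_space L,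
      continuous d,
      injective d,
      forall v : L, exists s : seq (R * X), v = \sum_(p <- s) p.1 *: d p.2 &
      forall E : tvsType R, hausdorff_space E ->
        forall f : X -> E, continuous f ->
          exists! fs : L -> E, [/\ linear fs, continuous fs & f = fs \o d]].

(* [fs] is the continuous linear extension f_# : L(X) -> L(Y) of [f], where
   [dX] and [dY] are the canonical injections of [X] and [Y]. *)
Definition is_sharp (R : realType) (X Y : topologicalType) (LX LY : tvsType R)
    (dX : X -> LX) (dY : Y -> LY) (f : X -> Y) (fs : LX -> LY) : Prop :=
  [/\ linear fs, continuous fs & fs \o dX = dY \o f].

(* Free locally convex spaces are unique up to a topological isomorphism
   compatible with the canonical injections, so it does not matter which
   models L(X), L(Y), L(Z), L(T) are used. *)
Definition L_equivalent (R : realType) (X Y Z T : topologicalType)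
    (f : X -> Y) (g : Z -> T) : Prop :=
  exists (LX LY LZ LT : tvsType R)
    (dX : X -> LX) (dY : Y -> LY) (dZ : Z -> LZ) (dT : T -> LT)
    (fs : LX -> LY) (gs : LZ -> LT) (phi : LX -> LZ) (psi : LY -> LT),
  [/\ [/\ is_free_lcs dX, is_free_lcs dY, is_free_lcs dZ & is_free_lcs dT],
      is_sharp dX dY f fs,
      is_sharp dZ dT g gs,
      (linear phi /\ homeomorphism phi) /\ (linear psi /\ homeomorphism psi) &
      psi \o fs = gs \o phi].

Definition L_invariant (R : realType)
    (P : forall X Y : topologicalType, (X -> Y) -> Prop) : Prop :=
  forall (X Y Z T : topologicalType) (f : X -> Y) (g : Z -> T),
    tychonoff_space X -> tychonoff_space Y ->
    tychonoff_space Z -> tychonoff_space T ->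
    continuous f -> continuous g ->
    L_equivalent R f g -> P X Y f -> P Z T g.

(* Main.v *)
Require Import Defs.
From HB Require Import structures.
From mathcomp Require Import all_boot all_order all_algebra.
From mathcomp Require Import all_classical all_reals topology normedtype.
From mathcomp Require Import convex sequences exp.
From mathcomp.multinomials Require Import freeg.

(** Two retractions [f], [g] of a Tychonoff space [X] onto one and the same
subspace [i : Y -> X] are always L-equivalent: on generators put
   phi(x) = x + i(f x) - i(g x)   and   psi = id.
Since [f] and [g] both send [i(y)] to [y], one gets
g_#(phi(x)) = g x + f x - g x = f x, and exchanging [f] and [g] in the formula
for [phi] gives its inverse.  Continuity of [phi] and of its inverse comes from
the universal property of L(X) alone
([parallel_retractions_L_equivalent]).

So it is enough to find two finite-to-one retractions onto the same subspace,
one closed and the other not.  Take two parallel copies of the real line,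
retracted onto the bottom one: the bottom line stays fixed and the top line is
carried to it by an injective continuous map [h].  For [h = id] this is the
projection of R * bool onto R, which is closed; for [h = expR] the image of the
closed top line is the set of positive reals, which is not closed.  A closed
continuous map with finite fibers is perfect, and this settles perfect maps
too.

L-equivalence speaks of actual free locally convex spaces, so these have to be
constructed ([free_lcs_is_free]).  L(X) is the vector space with basis [X],
with the coarsest topology that makes the linear extension of every continuous
map from [X] to every locally convex space continuous.  All axioms of a locally
convex space are then pulled back from the target spaces, and so is the
universal property; only the Hausdorff axiom uses that [X] is Tychonoff: a
nonzero combination of points is detected by a real function that is nonzero at
one of these points and vanishes at the others. *)

Set Implicit Arguments.
Unset Strict Implicit.
Unset Printing Implicit Defensive.

Import Order.TTheory GRing.Theory Num.Theory.
Import numFieldTopology.Exports.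

Local Open Scope classical_set_scope.
Local Open Scope ring_scope.

(** * Linear extension from a basis *)

Section linear_extension.
Variables (R : nzRingType) (K : choiceType) (M : lmodType R) (f : K -> M).

Lemma fglift_is_additive : {morph fglift f : u v / u - v}.
Proof. exact: lift_is_additive. Qed.

HB.instance Definition _ :=
  GRing.isZmodMorphism.Build {freeg K / R} M (fglift f) fglift_is_additive.

Lemma fglift_sumE (D : {freeg K / R}) :
  fglift f D = \sum_(x <- dom D) coeff x D *: f x.
Proof.
rewrite -{1}[D]freeg_sumE raddf_sum; apply: eq_bigr => x _.
exact: liftU.
Qed.

Lemma fglift_scalable : scalable (fglift f).
Proof.
move=> c D; rewrite [c *: D]/(fgscale c D) raddf_sum fglift_sumE scaler_sumr.
by apply: eq_bigr => x _; rewrite /= liftU scalerA.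
Qed.

HB.instance Definition _ :=
  GRing.isScalable.Build R {freeg K / R} M *:%R (fglift f) fglift_scalable.

Lemma fglift_unique (F : {freeg K / R} -> M) :
  linear F -> (forall x, F << x >> = f x) -> F = fglift f.
Proof.
move=> linF Ff; pose B := GRing.isLinear.Build R {freeg K / R} M _ F linF.
pose F' : {linear {freeg K / R} -> M} := HB.pack F B.
apply/funext => D; rewrite fglift_sumE -[in LHS](freeg_sumE D).
rewrite -[F _]/(F' _) linear_sum; apply: eq_bigr => x _ /=.
rewrite -Ff -[RHS]/(coeff x D *: F' << x >>) -linearZ; congr F.
apply/eqP/freeg_eqP => y.
by rewrite coeffZ !coeffU mul1r.
Qed.

End linear_extension.

(** * The free locally convex space *)

(** A copy of the free module, so that the topology below is attached to this
name only. *)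
Definition free_lcs (R : realType) (X : topologicalType) : Type :=
  {freeg X / R}.

Section free_lcs_topology.
Variables (R : realType) (X : topologicalType).

HB.instance Definition _ := GRing.Lmodule.on (free_lcs R X).

(** The initial topology for all linear extensions. The locally convex spaces
[E] form a large family, but they occur only under an existential quantifier in
[Prop], so no bound on their size is needed. *)
Definition free_lcs_nbhs (v : free_lcs R X) : set_system (free_lcs R X) :=
  [set U | exists (E : tvsType R) (f : X -> E) (W : set E),
     [/\ continuous f, nbhs (fglift f v) W & fglift f @^-1` W `<=` U]].

HB.instance Definition _ := hasNbhs.Build (free_lcs R X) free_lcs_nbhs.

Lemma nbhs_free_lcs (E : tvsType R) (f : X -> E) (v : free_lcs R X)
    (W : set E) :
  continuous f -> nbhs (fglift f v) W -> nbhs v (fglift f @^-1` W).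
Proof. by move=> cf nW; exists E, f, W; split. Qed.

(** Pairing turns two target spaces into one; this is why the sets
[fglift f @^-1` W] form a base of neighborhoods and not merely a subbase. *)
Lemma fglift_pair (E1 E2 : tvsType R) (f1 : X -> E1) (f2 : X -> E2)
    (v : free_lcs R X) :
  fglift (fun x => (f1 x, f2 x)) v = (fglift f1 v, fglift f2 v).
Proof.
symmetry; pose F (u : {freeg X / R}) := (fglift f1 u, fglift f2 u).
rewrite -[LHS]/(F v); congr (_ v); apply: fglift_unique => [a u w|x].
  by rewrite /F !linearP.
by rewrite /F !liftU !scale1r.
Qed.

Lemma free_lcs_nbhs_filter (v : free_lcs R X) : ProperFilter (nbhs v).
Proof.
split=> [[E [f [W [_ nW WU]]]]|]; first exact: (WU v (nbhs_singleton nW)).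
split=> [|U1 U2 [E1 [f1 [W1 [cf1 nW1 WU1]]]] [E2 [f2 [W2 [cf2 nW2 WU2]]]]|].
- exists R^o, (fun=> 0), setT; split=> //; first by move=> x; exact: cvg_cst.
  exact: filterT.
- exists (E1 * E2)%type, (fun x => (f1 x, f2 x)), (W1 `*` W2); split.
  + by move=> x; apply: cvg_pair; [exact: cf1|exact: cf2].
  + by rewrite fglift_pair; exists (W1, W2).
  + move=> u; rewrite /= fglift_pair => -[W1u W2u].
    by split; [exact: WU1|exact: WU2].
- move=> U1 U2 U12 [E [f [W [cf nW WU]]]]; exists E, f, W; split=> //.
  exact: subset_trans U12.
Qed.

Lemma free_lcs_nbhs_singleton (v : free_lcs R X) (U : set (free_lcs R X)) :
  nbhs v U -> U v.
Proof. by move=> [E [f [W [_ nW]]]]; apply; exact: nbhs_singleton. Qed.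

Lemma free_lcs_nbhs_nbhs (v : free_lcs R X) (U : set (free_lcs R X)) :
  nbhs v U -> nbhs v (nbhs^~ U).
Proof.
move=> [E [f [W [cf nW WU]]]]; exists E, f, (nbhs^~ W); split=> //.
  exact: nbhs_interior.
by move=> u nWu; exists E, f, W; split.
Qed.

HB.instance Definition _ := Nbhs_isNbhsTopological.Build (free_lcs R X)
  free_lcs_nbhs_filter free_lcs_nbhs_singleton free_lcs_nbhs_nbhs.

Lemma fglift_continuous (E : tvsType R) (f : X -> E) :
  continuous f -> continuous (fglift f : free_lcs R X -> E).
Proof. by move=> cf v W; exact: nbhs_free_lcs. Qed.

Lemma free_lcs_add_continuous :
  continuous (fun z : free_lcs R X * free_lcs R X => z.1 + z.2).
Proof.
move=> [u v] U [E [f [W [cf nW WU]]]].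
rewrite /= raddfD in nW.
have [[A B] /= [nA nB] AB] := @add_continuous E (fglift f u, fglift f v) W nW.
exists (fglift f @^-1` A, fglift f @^-1` B).
  by split; exact: nbhs_free_lcs.
move=> [u' v'] [/= Au' Bv']; apply: WU; rewrite /= raddfD.
exact: (AB (fglift f u', fglift f v')).
Qed.

Lemma free_lcs_scale_continuous :
  continuous (fun z : R^o * free_lcs R X => z.1 *: z.2).
Proof.
move=> [a v] U [E [f [W [cf nW WU]]]].
rewrite /= linearZ in nW.
have [[A B] /= [nA nB] AB] := @scale_continuous R E (a, fglift f v) W nW.
exists (A, fglift f @^-1` B); first by split=> //; exact: nbhs_free_lcs.
move=> [b w] [/= Ab Bw]; apply: WU; rewrite /= linearZ.
exact: (AB (b, fglift f w)).
Qed.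

Lemma free_lcs_locally_convex : exists2 B : set_system (free_lcs R X),
  (forall b, b \in B -> convex_set b) & basis B.
Proof.
exists [set U | exists (E : tvsType R) (f : X -> E) (C : set E),
    [/\ continuous f, open C, convex_set C & U = fglift f @^-1` C]].
  move=> U; rewrite inE => -[E [f [C [_ _ cC ->]]]] u v a.
  rewrite !inE /= => Cu Cv; apply/set_mem.
  suff -> : fglift f (conv a (u : convex_lmodType (free_lcs R X)) v) =
      conv a (fglift f u : convex_lmodType E) (fglift f v).
    by apply: cC; exact/mem_set.
  by rewrite /conv /= linearD !linearZ.
split=> [U [E [f [C [cf oC _ ->]]]]|v U [E [f [W [cf nW WU]]]]].
  by apply: open_comp oC => v _; exact: fglift_continuous.
have [B cB [oB bB]] := @locally_convex R E.
have [C [BC Cv] CW] := bB _ _ nW.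
exists (fglift f @^-1` C); last by move=> u /CW /WU.
split=> //; exists E, f, C; split=> //; first exact: oB.
exact/cB/mem_set.
Qed.

(* This instance equips the space with the translation-invariant uniformity of
   its topology; those after it record the compatibility of this uniform space
   with the operations and its local convexity. *)
HB.instance Definition _ := PreTopologicalLmod_isTvs.Build R (free_lcs R X)
  free_lcs_add_continuous free_lcs_scale_continuous free_lcs_locally_convex.
HB.instance Definition _ :=
  PreTopologicalNmodule_isTopologicalNmodule.Build (free_lcs R X)
    free_lcs_add_continuous.
HB.instance Definition _ :=
  TopologicalNmodule_isTopologicalLmodule.Build R (free_lcs R X)
    free_lcs_scale_continuous.
HB.instance Definition _ :=
  Uniform_isTvs.Build R (free_lcs R X) free_lcs_locally_convex.

End free_lcs_topology.

Section free_lcs_universal.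
Variables (R : realType) (X : topologicalType).

Definition free_lcs_in (x : X) : free_lcs R X := << x >>.

Lemma coeff_free_lcs_in (x y : X) : coeff y (free_lcs_in x) = (x == y)%:R.
Proof. by rewrite coeffU mul1r. Qed.

Lemma free_lcs_in_inj : injective free_lcs_in.
Proof.
move=> x y /(congr1 (coeff x)); rewrite !coeff_free_lcs_in eqxx.
by case: eqVneq => // _ /eqP; rewrite oner_eq0.
Qed.

Lemma fglift_in (E : lmodType R) (f : X -> E) x :
  fglift f (free_lcs_in x) = f x.
Proof. by rewrite liftU scale1r. Qed.

Lemma free_lcs_in_continuous : continuous free_lcs_in.
Proof.
move=> x U [E [f [W [cf]]]]; rewrite fglift_in => nW WU.
have nfW : nbhs x (f @^-1` W) := cf x W nW.
rewrite /= nbhs_simpl; apply: filterS nfW => y Wy.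
by apply: WU; rewrite /= fglift_in.
Qed.

(** Complete regularity gives [g] with [g x = 0] at a chosen point [x] of the
support of [v] and [g = 1] on the rest of the support, a finite and hence closed
set; the extension of [1 - g] maps [v] to its coefficient at [x]. *)
Lemma fglift_separates (v : free_lcs R X) : tychonoff_space X -> v != 0 ->
  exists2 f : X -> R^o, continuous f & fglift f v != 0.
Proof.
move=> [accX crX]; rewrite -dom_eq0 => dv.
have [x xv] : exists x, x \in dom v.
  by case: (dom v) dv => // x s _; exists x; rewrite inE eqxx.
pose B : set X := [set` rem x (dom v)].
have clB : closed B.
  by move/accessible_finite_set_closed: accX; apply; exact: finite_seq.
have nBx : ~ B x by rewrite /B /= mem_rem_uniqF// uniq_dom.
have /(@uniform_separatorP _ R)[g [cg _ g0 g1]] := crX x B clB nBx.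
exists (fun y => 1 - g y).
  move=> y; apply: cvgB; [exact: cvg_cst|exact: cg].
rewrite fglift_sumE (bigD1_seq x) ?uniq_dom//= [X in _ + X]big_seq_cond.
rewrite big1 => [|y /andP[yv yx]].
  rewrite addr0 (g0 (g x)) ?subr0; last by exists x.
  by rewrite [_ *: _]mulr1 -mem_dom.
rewrite (g1 (g y)) ?subrr ?scaler0//; exists y => //.
by rewrite /B /= mem_rem_uniq ?uniq_dom// inE yx.
Qed.

Lemma free_lcs_hausdorff : tychonoff_space X -> hausdorff_space (free_lcs R X).
Proof.
move=> tX u v cuv; apply/eqP; rewrite -subr_eq0; apply/negPn/negP => uv0.
have [f cf] := fglift_separates tX uv0.
rewrite raddfB subr_eq0 => /eqP; apply.
apply: (@Rhausdorff R) => A B nA nB.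
have [w [Aw Bw]] := cuv _ _ (fglift_continuous cf nA) (fglift_continuous cf nB).
by exists (fglift f w).
Qed.

Theorem free_lcs_is_free :
  tychonoff_space X -> @is_free_lcs R X (free_lcs R X) free_lcs_in.
Proof.
move=> tX; split.
- exact: free_lcs_hausdorff.
- exact: free_lcs_in_continuous.
- exact: free_lcs_in_inj.
- move=> v; exists [seq (coeff x v, x) | x <- dom v].
  rewrite big_map -[LHS]freeg_sumE; apply: eq_bigr => x _.
  by apply/eqP/freeg_eqP => y; rewrite coeffZ coeff_free_lcs_in coeffU.
- move=> E _ f cf; exists (fglift f); split.
    split; first exact: linearP.
      exact: fglift_continuous.
    by apply/funext => x /=; rewrite fglift_in.
  move=> F [linF _ fF]; apply/esym/fglift_unique => // x.
  by rewrite fF.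
Qed.

End free_lcs_universal.

(** * L-equivalence of parallel retractions *)

Section free_lcs_theory.
Variables (R : realType) (X : topologicalType) (L E : tvsType R) (d : X -> L).
Hypothesis dP : is_free_lcs d.

Lemma free_lcs_extend (f : X -> E) : hausdorff_space E -> continuous f ->
  exists2 F : {linear L -> E}, continuous F & forall x, F (d x) = f x.
Proof.
move=> hE cf; have [_ _ _ _ univ] := dP.
have [F [[linF cF fF] _]] := univ E hE f cf.
pose B := GRing.isLinear.Build R L E _ F linF.
exists (HB.pack F B : {linear L -> E}) => //.
by move=> x; rewrite fF.
Qed.

Lemma free_lcs_ext (F G : {linear L -> E}) :
  (forall x, F (d x) = G (d x)) -> F =1 G.
Proof.
move=> FG v; have [_ _ _ span _] := dP; have [s ->] := span v.
by rewrite !linear_sum; apply: eq_bigr => p _; rewrite !linearZ /= FG.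
Qed.

End free_lcs_theory.

Section parallel_retractions.
Variables (R : realType) (X Y : topologicalType) (L : tvsType R) (d : X -> L).
Hypothesis dP : is_free_lcs d.
Variables (i : Y -> X) (f g : X -> Y).
Hypotheses (ci : continuous i) (cf : continuous f) (cg : continuous g).

(** This is the isomorphism [phi]; with [f] and [g] exchanged it is the inverse
of [phi]. *)
Lemma free_lcs_shift : exists2 F : {linear L -> L},
  continuous F & forall x, F (d x) = d x + d (i (f x)) - d (i (g x)).
Proof.
have [hL cd _ _ _] := dP.
have cdi (h : X -> Y) : continuous h -> continuous (d \o i \o h).
  move=> ch x; apply: continuous_comp; first exact: ch.
  by apply: continuous_comp; [exact: ci|exact: cd].
apply: free_lcs_extend => // x.
apply: (@continuous_comp _ _ _ (fun y => (d y + d (i (f y)), d (i (g y))))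
  (fun z : L * L => z.1 - z.2)); last exact: sub_continuous.
apply: cvg_pair; last exact: cdi.
apply: (@continuous_comp _ _ _ (fun y => (d y, d (i (f y))))
  (fun z : L * L => z.1 + z.2)); last exact: add_continuous.
by apply: cvg_pair; [exact: cd|exact: cdi].
Qed.

(** On a generator, [G] sends [d x + d (i (f x)) - d (i (g x))] to
[(d x + d (i (g x)) - d (i (f x))) + d (i (f x)) - d (i (g x))]: each point of
the subspace is fixed by both maps, because [f] and [g] agree on it. *)
Lemma free_lcs_shiftK (F G : {linear L -> L}) : cancel i f -> cancel i g ->
  (forall x, F (d x) = d x + d (i (f x)) - d (i (g x))) ->
  (forall x, G (d x) = d x + d (i (g x)) - d (i (f x))) ->
  cancel F G.
Proof.
move=> fK gK FE GE.
apply: (free_lcs_ext dP (F := G \o F) (G := idfun)) => x /=.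
rewrite FE linearB linearD /= !GE !(fK, gK) !addrK.
by rewrite subrK addrK.
Qed.

End parallel_retractions.

Theorem parallel_retractions_L_equivalent (R : realType)
    (X Y : topologicalType) (i : Y -> X) (f g : X -> Y) :
  tychonoff_space X -> tychonoff_space Y ->
  continuous i -> continuous f -> continuous g ->
  cancel i f -> cancel i g -> L_equivalent R f g.
Proof.
move=> tX tY ci cf cg fK gK.
have dX := free_lcs_is_free R tX; have dY := free_lcs_is_free R tY.
have ext (h : X -> Y) : continuous h ->
    exists2 F : {linear free_lcs R X -> free_lcs R Y}, continuous F &
      forall x, F (free_lcs_in R x) = free_lcs_in R (h x).
  move=> ch; apply: (@free_lcs_extend R X _ (free_lcs R Y) _ dX
    (fun x => free_lcs_in R (h x))); first exact: free_lcs_hausdorff.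
  move=> x; apply: continuous_comp; first exact: ch.
  exact: free_lcs_in_continuous.
have [fs cfs fsE] := ext f cf; have [gs cgs gsE] := ext g cg.
have [phi cphi phiE] := free_lcs_shift dX ci cf cg.
have [chi cchi chiE] := free_lcs_shift dX ci cg cf.
exists (free_lcs R X), (free_lcs R Y), (free_lcs R X), (free_lcs R Y).
exists (@free_lcs_in R X), (@free_lcs_in R Y), (@free_lcs_in R X).
exists (@free_lcs_in R Y), fs, gs, phi, idfun; split=> //.
- by split=> //; [exact: linearP|exact/funext].
- by split=> //; [exact: linearP|exact/funext].
- split; split=> //; first exact: linearP.
    split=> //; exists chi; split=> //.
      exact: free_lcs_shiftK phiE chiE.
    exact: free_lcs_shiftK chiE phiE.
  split; first by move=> v; exact: cvg_id.
  by exists idfun; split=> // v; exact: cvg_id.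
apply/funext; apply: (free_lcs_ext dX (F := fs) (G := gs \o phi)) => x /=.
by rewrite fsE phiE linearB linearD /= !gsE !gK addrAC subrr add0r.
Qed.

(** * Two parallel lines *)

Lemma uniform_tychonoff (R : realType) (T : uniformType) :
  hausdorff_space T -> tychonoff_space T.
Proof.
move=> hT; split; first exact: hausdorff_accessible.
exact: (@uniform_completely_regular R).
Qed.

Lemma perfect_closed_finite_to_one (X Y : topologicalType) (f : X -> Y) :
  continuous f -> closed_map f -> finite_to_one f -> perfect_map f.
Proof. by move=> cf clf ff; split=> // y; exact/finite_compact/ff. Qed.

Section two_lines.
Variable R : realType.

Local Notation X := (R * bool)%type.

(** The points [(x, true)] form the top line, which [h] folds onto the bottom
line. *)
Definition collapse (h : R -> R) (z : X) : R := if z.2 then h z.1 else z.1.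

Definition bottom_line (x : R) : X := (x, false).

Lemma line_continuous b : continuous (fun x : R => (x, b) : X).
Proof. by move=> x; exact: (cvg_pair cvg_id (cvg_cst b)). Qed.

Lemma collapse_continuous h : continuous h -> continuous (collapse h).
Proof.
move=> ch [x b] W nW.
pose k := if b then h else id.
have nkW : nbhs x (k @^-1` W).
  by case: (b) @k nW => // nW; exact: ch.
exists (k @^-1` W, [set b]); first by split=> //; exact: discrete_set1.
move=> [y c] [/= Wy ->]; rewrite /collapse /=.
by move: Wy; rewrite /k; case: (b).
Qed.

Lemma bottom_line_embedding : embedding bottom_line.
Proof.
split=> [x y []//||U oU]; first exact: line_continuous.
exists (fst @^-1` U) => //; apply: open_comp oU => z _; exact: cvg_fst.
Qed.

Lemma collapse_retraction h : continuous h -> retraction (collapse h).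
Proof.
move=> ch; split; first exact: collapse_continuous.
by exists bottom_line => //; exact: bottom_line_embedding.
Qed.

Lemma collapse_finite_to_one h : injective h -> finite_to_one (collapse h).
Proof.
move=> hI y.
have sub : collapse h @^-1` [set y] `<=`
    [set bottom_line y] `|` [set z : X | z.2 /\ h z.1 = y].
  by move=> [x []] /= <-; [right|left].
apply: (sub_finite_set sub); rewrite finite_setU.
split; first exact: finite_set1.
have [[x hx]|nx] := pselect (exists x, h x = y); last first.
  apply: (@sub_finite_set _ _ set0) => [[x b] [_ hx]|]; last exact: finite_set0.
  by apply: nx; exists x.
apply: (@sub_finite_set _ _ [set (x, true)]); last exact: finite_set1.
by move=> [x' []] [//= _]; rewrite -hx => /hI ->.
Qed.

Lemma collapse_id_closed : closed_map (collapse id).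
Proof.
move=> A clA.
have -> : collapse id @` A = [set x | A (x, false)] `|` [set x | A (x, true)].
  apply/seteqP; split=> [x [[y []] Ay <-]|x [Ax|Ax]]; [by right|by left|..].
    by exists (x, false).
  by exists (x, true).
by apply: closedU; apply: (closed_comp _ clA) => x _; exact: line_continuous.
Qed.

(** The top line is closed and its image consists of the positive reals, whose
closure contains 0. *)
Lemma collapse_expR_not_closed : ~ closed_map (collapse (@expR R)).
Proof.
move=> /(_ (snd @^-1` [set true])) clg.
have /clg cl : closed ((snd : X -> bool) @^-1` [set true]).
  apply: closed_comp (discrete_closed _) => z _; exact: cvg_snd.
have : closure (collapse (@expR R) @` (snd @^-1` [set true])) 0.
  move=> B /nbhs_ballP[e /= e0 eB]; exists (e / 2); split.
    exists (ln (e / 2), true) => //=; rewrite /collapse /= lnK// posrE.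
    exact: divr_gt0.
  apply: eB; rewrite /ball /= sub0r normrN gtr0_norm ?divr_gt0//.
  by rewrite ltr_pdivrMr// ltr_pMr// ltr1n.
move=> /cl [[x b]] /= -> /eqP; rewrite /collapse /= gt_eqF//.
exact: expR_gt0.
Qed.

Lemma line_tychonoff : tychonoff_space R.
Proof. apply: (@uniform_tychonoff R R); exact: Rhausdorff. Qed.

Lemma two_lines_tychonoff : tychonoff_space X.
Proof.
apply: (@uniform_tychonoff R) => -[x b] [y c] cl.
have sep (U : topologicalType) (k : X -> U) :
    hausdorff_space U -> continuous k -> k (x, b) = k (y, c).
  move=> hU ck; apply: hU => A B nA nB.
  by have [z [Az Bz]] := cl _ _ (ck _ _ nA) (ck _ _ nB); exists (k z).
have /= -> : (x, b).1 = (y, c).1.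
  by apply: (sep R fst); [exact: Rhausdorff|move=> z; exact: cvg_fst].
have /= -> // : (x, b).2 = (y, c).2.
by apply: (sep bool snd); [exact: discrete_hausdorff|move=> z; exact: cvg_snd].
Qed.

Lemma collapse_L_equivalent h k : continuous h -> continuous k ->
  L_equivalent R (collapse h) (collapse k).
Proof.
move=> ch ck.
apply: (@parallel_retractions_L_equivalent _ _ _ bottom_line) => //.
- exact: two_lines_tychonoff.
- exact: line_tychonoff.
- exact: line_continuous.
- exact: collapse_continuous.
- exact: collapse_continuous.
Qed.

End two_lines.

Theorem corollary4p16 (R : realType) :
  (exists (X Y Z T : topologicalType) (f : X -> Y) (g : Z -> T),
     [/\ [/\ tychonoff_space X, tychonoff_space Y,
             tychonoff_space Z & tychonoff_space T],
         (retraction f /\ finite_to_one f) /\ (retraction g /\ finite_to_one g),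
         L_equivalent R f g,
         closed_map f &
         ~ closed_map g])
  /\
  (~ L_invariant R perfect_map
   /\
   exists (X Y Z T : topologicalType) (f : X -> Y) (g : Z -> T),
     [/\ [/\ tychonoff_space X, tychonoff_space Y,
             tychonoff_space Z & tychonoff_space T],
         continuous f /\ continuous g,
         L_equivalent R f g,
         perfect_map f &
         ~ perfect_map g]).
Proof.
pose X : topologicalType := (R * bool)%type.
pose f : X -> R := collapse id; pose g : X -> R := collapse (@expR R).
have tX : tychonoff_space X := two_lines_tychonoff R.
have tR := line_tychonoff R.
have cid : continuous (id : R -> R) by move=> x; exact: cvg_id.
have cexp := @continuous_expR R.
have [rf rg] : retraction f /\ retraction g.
  by split; exact: collapse_retraction.
have ff : finite_to_one f by apply: collapse_finite_to_one.
have fg : finite_to_one g by apply: collapse_finite_to_one; exact: expR_inj.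
have Lfg : L_equivalent R f g by exact: collapse_L_equivalent.
have clf : closed_map f := @collapse_id_closed R.
have nclg : ~ closed_map g := @collapse_expR_not_closed R.
have [[cf _] [cg _]] := (rf, rg).
have pf : perfect_map f by exact: perfect_closed_finite_to_one.
have npg : ~ perfect_map g by case.
split; first by exists X, R, X, R, f, g.
split; last by exists X, R, X, R, f, g.
by move=> inv; apply: npg; exact: (inv X R X R f g).
Qed.
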